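(* Let $\mathbb{U}$ be an Absolute Universe of combinatorial games. Consider the structure whose objects are the games in $\mathbb{U}$ and whose morphism sets are, for $G,H\in\mathbb{U}$, $\mathrm{Hom}(H,G)=\mathcal{L}_R(H,G)$ (the set of Left Maintenance Strategies in the Left Provisional Game $[G,H]$ with Right starting) if $G\succcurlyeq H$, and $\mathrm{Hom}(H,G)=\emptyset$ otherwise; the composition of $f\in\mathrm{Hom}(H,J)$ and $g\in\mathrm{Hom}(J,G)$ is the residual strategy $g\circ f=g\circledast f$. Then this structure is a category: composition is a well-defined map $\mathrm{Hom}(J,G)\times\mathrm{Hom}(H,J)\to\mathrm{Hom}(H,G)$, it is associative, and every object $G$ has an identity morphism in $\mathrm{Hom}(G,G)$.
   Context: **Free space.** Let $(\mathbb{A},+)$ be a totally ordered additive group. A game $G=\langle G^{\mathcal L}\mid G^{\mathcal R}\rangle$ is given by its Left and Right options. If Left has no options we write $G^{\mathcal L}=\emptyset^{\ell}$ for some $\ell\in\mathbb{A}$ (an atom with adorn $\ell$) and $G$ is called left-atomic; if Right has no options we write $G^{\mathcal R}=\emptyset^{r}$, $r\in\mathbb{A}$, and $G$ is called right-atomic. A typical Left (Right) option is denoted $G^L$ ($G^R$); $G^{RL}$ is a Left option of $G^R$, etc. Let $\Omega_0=\{\langle\emptyset^\ell\mid\emptyset^r\rangle:\ell,r\in\mathbb{A}\}$; for $n>0$, $\Omega_n$ is the set of all games with finite sets of options in $\Omega_{n-1}$, including games that are left- and/or right-atomic. The free space is $\Omega=\bigcup_{n\ge0}\Omega_n$. Games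 are literal forms (trees). **Disjunctive sum.** $G+H$ is defined recursively. If $G$ and $H$ are both left-atomic with adorns $\ell_1,\ell_2$, then $G+H$ is left-atomic with adorn $\ell_1+\ell_2$; otherwise its Left options are all $G^L+H$ and all $G+H^L$. If $G$ and $H$ are both right-atomic with adorns $r_1,r_2$, then $G+H$ is right-atomic with adorn $r_1+r_2$; otherwise its Right options are all $G^R+H$ and all $G+H^R$. **Game space and outcomes.** A combinatorial game space consists of $\Omega$ with $+$, a totally ordered set $\mathbb{S}$ of results, and order-preserving maps $\nu_L,\nu_R:\mathbb{A}\to\mathbb{S}$, where $\nu_L=\nu_R$ is required if $|\mathbb{A}|>1$. It is assumed that $\mathbb{S}=\nu_L(\mathbb{A})\cup\nu_R(\mathbb{A})$. The outcome functions $o_L,o_R:\Omega\to\mathbb{S}$ are: $o_L(G)=\nu_L(\ell)$ if $G^{\mathcal L}=\emptyset^\ell$, and $o_L(G)=\max o_R(G^L)$ over all Left options otherwise; $o_R(G)=\nu_R(r)$ if $G^{\mathcal R}=\emptyset^r$, and $o_R(G)=\min o_L(G^R)$ over all Right options otherwise. **Conjugate.** $\overset{\leftrightarrow}{G}$ is obtained recursively by swapping Left and Right: its Left options are the conjugates of the Right options of $G$ (or the atom $\emptyset^{-r}$ if $G^{\mathcal R}=\emptyset^r$), and its Right options are the conjugates of the Left options of $G$ (or the atom $\emptyset^{-\ell}$ if $G^{\mathcal L}=\emptyset^\ell$). **Absolute Universe.** A universe $\mathbb{U}\subseteq\Omega$ is a set of games containing $\langle\emptyset^a\mid\emptyset^a\rangle$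 for all $a\in\mathbb{A}$, and closed under taking options, under disjunctive sum, and under conjugation. It is parental if $\langle\mathcal A\mid\mathcal B\rangle\in\mathbb{U}$ for all finite non-empty $\mathcal A,\mathcal B\subset\mathbb{U}$. It is dense if for all $G\in\mathbb{U}$ and all $x,y\in\mathbb{S}$ there is $H\in\mathbb{U}$ with $o_L(G+H)=x$ and $o_R(G+H)=y$. An Absolute Universe is a universe that is both parental and dense. **Order.** For $G,H\in\mathbb{U}$, $G\succcurlyeq H$ (modulo $\mathbb{U}$) means that $o_L(G+X)\geq o_L(H+X)$ and $o_R(G+X)\geq o_R(H+X)$ for all $X\in\mathbb{U}$. **Proviso.** $[G,H]\in\mathrm{Proviso}(\mathbb{U})$ means: $o_L(G+X)\geq o_L(H+X)$ for all left-atomic $X\in\mathbb{U}$, and $o_R(G+X)\geq o_R(H+X)$ for all right-atomic $X\in\mathbb{U}$. **Left Provisional Game (LPG).** Its positions are ordered pairs $[G,H]\in\mathbb{U}\times\mathbb{U}$. The Left options of $[G,H]$ are those pairs $[G^L,H]$ ($G^L$ a Left option of $G$) and $[G,H^R]$ ($H^R$ a Right option of $H$) which lie in $\mathrm{Proviso}(\mathbb{U})$. The Right options of $[G,H]$ are all pairs $[G^R,H]$ and $[G,H^L]$ (no restriction). Players alternate, and a player who cannot move loses. Thus $[G,H]$ is a normal-play game, for every $\mathbb{U}$. **Left Maintenance Strategies.** A Left Maintenance Strategy in $[G,H]$ prescribes, at every stage where Right makes a move, a legal Left response (so Left can always answer Right). $\mathcal{L}_R(H,G)$ is the set of Left Maintenance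 Strategies in $[G,H]$ when Right starts, and $\mathcal{L}_L(H,G)$ the set when Left starts (note the reversed order of the arguments). Recursively: an element of $\mathcal{L}_R(H,G)$ is a choice of an element of $\mathcal{L}_L(H,G^R)$ for every Right option $G^R$ of $G$ together with a choice of an element of $\mathcal{L}_L(H^L,G)$ for every Left option $H^L$ of $H$; an element of $\mathcal{L}_L(H,G)$ is a choice of a legal Left move, either $G\to G^L$ with $[G^L,H]\in\mathrm{Proviso}(\mathbb{U})$ or $H\to H^R$ with $[G,H^R]\in\mathrm{Proviso}(\mathbb{U})$, together with an element of $\mathcal{L}_R(H,G^L)$, respectively $\mathcal{L}_R(H^R,G)$ (the continuation strategy). **Residual strategy.** Given $g\in\mathcal{L}_R(J,G)$ (a strategy in $[G,J]$) and $f\in\mathcal{L}_R(H,J)$ (a strategy in $[J,H]$), the residual strategy $g\circledast f$ in $[G,H]$ is defined as follows. Suppose Right moves $G\to G^R$ in $[G,H]$. Left considers this as Right's move in $[G,J]$ and looks at $g$'s response. If it is a move $G^R\to G^{RL}$, Left plays $[G^{RL},H]$ in $[G^R,H]$. If it is a move $J\to J^R$, Left considers this as Right's move in $[J,H]$ and looks at $f$'s response in $[J^R,H]$: if it is $H\to H^R$, Left plays $[G^R,H^R]$; if it is $J^R\to J^{RL}$, this is considered as Right's next move in the game $[G^R,J^R]$, giving $[G^R,J^{RL}]$, to which (the continuation of) $g$ responds, and so on. As $J$ is finite, eventually a response of the form $G^{RL}$ or $H^R$ occurs, and this is Left's response in $[G^R,H]$. Analogously, if Right moves $H\to H^L$ in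 $[G,H]$, this is considered first as Right's move in $[J,H]$, answered by $f$; a response $H^L\to H^{LR}$ is Left's response in $[G,H^L]$, while a response $J\to J^L$ is considered as Right's move in $[G,J]$, answered by $g$, and so on until a response in the first component (a move $G\to G^L$) or in the last component (a move $H^L\to H^{LR}$) occurs. After Left's response, the play continues in the same way with the residual strategy formed from the current continuations of $g$ and $f$. *)

(* Defs.v *)
(* Mathematical Components (algebra, order) and finmap; no classical axioms. *)
From HB Require Import structures.
From mathcomp Require Import all_boot all_order all_algebra.
From mathcomp Require Import finmap.

Set Implicit Arguments.
Unset Strict Implicit.
Unset Printing Implicit Defensive.

Import Order.TTheory GRing.Theory.
Local Open Scope fset_scope.
Local Open Scope ring_scope.

(* Games have finite SETS of options.  [tree] uses lists instead; a game is a
   tree in which every option list is nonempty and is the canonical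
   (duplicate-free, order-fixing) enumeration [sort_keys] of the set of its
   elements, exactly as finmap represents {fset K}.  Hence Leibniz equality of
   games is equality of literal forms.  After the lemmas [ladorn_gadd] ...
   [oR_max] the representation can be forgotten. *)
Section Tree.
Variable A : choiceType.

Inductive tree := Node of A + seq tree & A + seq tree.

Definition tleft t := let: Node l _ := t in l.
Definition tright t := let: Node _ r := t in r.
Definition topts (s : A + seq tree) := if s is inr xs then xs else [::].
Definition tadorn (s : A + seq tree) := if s is inl a then Some a else None.

Definition all_prop (P : tree -> Prop) := foldr (fun t => and (P t)) True.

Lemma tree_ind' (P : tree -> Prop) :
  (forall l r, all_prop P (topts l) -> all_prop P (topts r) -> P (Node l r)) ->
  forall t, P t.
Proof.
move=> IH; fix rec 1 => -[l r]; apply: IH.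
- case: l => [a|/=]; first exact: I.
  by elim=> [|x xs IHxs] /=; [exact: I | split; [exact: rec | exact: IHxs]].
- case: r => [a|/=]; first exact: I.
  by elim=> [|x xs IHxs] /=; [exact: I | split; [exact: rec | exact: IHxs]].
Qed.

Fixpoint tencode t : GenTree.tree A :=
  let: Node l r := t in
  let es s := match s with
    | inl a => GenTree.Leaf a
    | inr xs => GenTree.Node 0 (map tencode xs)
    end in
  GenTree.Node 0 [:: es l; es r].

Fixpoint tdecode (g : GenTree.tree A) : tree :=
  let ds h := match h with
    | GenTree.Leaf a => inl a
    | GenTree.Node _ hs => inr (map tdecode hs)
    end in
  match g with
  | GenTree.Node _ [:: x; y] => Node (ds x) (ds y)
  | _ => Node (inr [::]) (inr [::])
  end.

Lemma tencodeK : cancel tencode tdecode.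
Proof.
elim/tree_ind' => l r IHl IHr /=.
have mapK xs : all_prop (fun t => tdecode (tencode t) = t) xs ->
    map tdecode (map tencode xs) = xs.
  by elim: xs => //= x xs IH [-> /IH ->].
by congr Node; [case: l IHl {IHr} | case: r IHr {IHl}] => //= xs /mapK ->.
Qed.

HB.instance Definition _ := Choice.copy tree (can_type tencodeK).

Lemma tree_indm (P : tree -> Prop) :
  (forall t, {in topts (tleft t), forall x, P x} ->
     {in topts (tright t), forall x, P x} -> P t) ->
  forall t, P t.
Proof.
have allP xs : all_prop P xs -> {in xs, forall x, P x}.
  elim: xs => //= y ys IH [Py /IH Pys] x.
  by rewrite inE => /predU1P[->|/Pys].
by move=> IH; elim/tree_ind' => l r /allP Hl /allP Hr; apply: IH.
Qed.

Fixpoint literal (t : tree) : bool :=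
  let ok s := match s with
    | inl _ => true
    | inr xs => [&& xs != [::], canonical_keys xs & all literal xs]
    end in
  let: Node l r := t in ok l && ok r.

Definition literal_side (s : A + seq tree) :=
  if s is inr xs then [&& xs != [::], canonical_keys xs & all literal xs]
  else true.

Lemma literalE t : literal t = literal_side (tleft t) && literal_side (tright t).
Proof. by case: t. Qed.

Record game := Game { tree_of : tree; game_literal : literal tree_of }.

HB.instance Definition _ := [isSub for tree_of].
HB.instance Definition _ := [Choice of game by <:].

Definition side_opts (s : A + seq tree) : {fset game} :=
  [fset X in (pmap insub (topts s) : seq game)].

(* The adorn is [None] when the player has options. *)
Definition ladorn (G : game) : option A := tadorn (tleft (tree_of G)).
Definition radorn (G : game) : option A := tadorn (tright (tree_of G)).
Definition lopts (G : game) : {fset game} := side_opts (tleft (tree_of G)).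
Definition ropts (G : game) : {fset game} := side_opts (tright (tree_of G)).

Definition left_atomic (G : game) : bool := isSome (ladorn G).
Definition right_atomic (G : game) : bool := isSome (radorn G).

Definition nonempty_side (s : A + {fset game}) : bool :=
  if s is inr X then X != fset0 else true.

Definition tree_side (s : A + {fset game}) : A + seq tree :=
  match s with
  | inl a => inl a
  | inr X => inr (sort_keys [seq tree_of G | G <- enum_fset X])
  end.

Lemma sort_keys_eq0 (K : choiceType) (xs : seq K) :
  (sort_keys xs == [::]) = (xs == [::]).
Proof.
case: xs => [|x xs]; first by rewrite sort_keys_nil.
have : x \in sort_keys (x :: xs) by rewrite sort_keysE mem_head.
by case: (sort_keys _).
Qed.

Lemma tree_side_literal s : nonempty_side s -> literal_side (tree_side s).
Proof.
case: s => //= X X0; rewrite sort_keys_eq0 canonical_sort_keys /=.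
apply/andP; split.
  have /fset0Pn[x xX] := X0; apply/negP => /eqP X0'.
  have : tree_of x \in [seq tree_of G | G <- enum_fset X] by apply: map_f.
  by rewrite X0'.
by apply/allP => t; rewrite sort_keysE => /mapP[G _ ->]; exact: game_literal.
Qed.

Fact gform_literal l r (hl : nonempty_side l) (hr : nonempty_side r) :
  literal (Node (tree_side l) (tree_side r)).
Proof. by rewrite literalE /= !tree_side_literal. Qed.

(* < l | r > *)
Definition gform l r (hl : nonempty_side l) (hr : nonempty_side r) : game :=
  Game (gform_literal hl hr).

Lemma mem_side_opts s (X : game) : (X \in side_opts s) = (tree_of X \in topts s).
Proof.
rewrite inE /= mem_pmap; apply/mapP/idP => [[t]|Xs].
  by case: insubP => // Y _ <- Ys [->].
by exists (tree_of X) => //; rewrite (valK X).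
Qed.

Lemma mem_lopts (G X : game) :
  (X \in lopts G) = (tree_of X \in topts (tleft (tree_of G))).
Proof. exact: mem_side_opts. Qed.

Lemma mem_ropts (G X : game) :
  (X \in ropts G) = (tree_of X \in topts (tright (tree_of G))).
Proof. exact: mem_side_opts. Qed.

Lemma topts_literal s t : literal_side s -> t \in topts s -> literal t.
Proof. by case: s => //= xs /and3P[_ _ /allP]; apply. Qed.

Lemma literal_left (G : game) : literal_side (tleft (tree_of G)).
Proof. by have := game_literal G; rewrite literalE => /andP[]. Qed.

Lemma literal_right (G : game) : literal_side (tright (tree_of G)).
Proof. by have := game_literal G; rewrite literalE => /andP[]. Qed.

Lemma lopts_eq0 G : (lopts G == fset0) = left_atomic G.
Proof.
have := literal_left G; rewrite /left_atomic /ladorn /lopts.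
case: (tleft _) => [a|xs] lit.
  by apply/eqP/fsetP => X; rewrite mem_side_opts.
have /and3P[xs0 _ _] := lit; apply/negbTE/fset0Pn.
case: xs xs0 lit => // x xs _ lit.
have lx : literal x by apply: (topts_literal lit); exact: mem_head.
by exists (Game lx); rewrite mem_side_opts mem_head.
Qed.

Lemma ropts_eq0 G : (ropts G == fset0) = right_atomic G.
Proof.
have := literal_right G; rewrite /right_atomic /radorn /ropts.
case: (tright _) => [a|xs] lit.
  by apply/eqP/fsetP => X; rewrite mem_side_opts.
have /and3P[xs0 _ _] := lit; apply/negbTE/fset0Pn.
case: xs xs0 lit => // x xs _ lit.
have lx : literal x by apply: (topts_literal lit); exact: mem_head.
by exists (Game lx); rewrite mem_side_opts mem_head.
Qed.

Lemma side_ext s s' : literal_side s -> literal_side s' ->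
  tadorn s = tadorn s' -> side_opts s = side_opts s' -> s = s'.
Proof.
case: s s' => [a|xs] [b|ys] //=; first by move=> _ _ [->].
move=> lx ly _ /fsetP eqs; congr inr.
have /and3P[_ cx _] := lx; have /and3P[_ cy _] := ly.
apply: canonical_eq_keys => // t; apply/idP/idP => tin.
  have lt := topts_literal (lx : literal_side (inr xs)) tin.
  by have := eqs (Game lt); rewrite !mem_side_opts /= tin => <-.
have lt := topts_literal (ly : literal_side (inr ys)) tin.
by have := eqs (Game lt); rewrite !mem_side_opts /= tin => ->.
Qed.

Lemma game_ext (G H : game) :
  ladorn G = ladorn H -> radorn G = radorn H ->
  lopts G = lopts H -> ropts G = ropts H -> G = H.
Proof.
move=> eal ear eol eor; apply: val_inj => /=.
have := side_ext (literal_left G) (literal_left H) eal eol.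
have := side_ext (literal_right G) (literal_right H) ear eor.
by case: (tree_of G) (tree_of H) => [l r] [l' r'] /= -> ->.
Qed.

Lemma game_ind_opts (P : game -> Prop) :
  (forall G, {in lopts G, forall X, P X} -> {in ropts G, forall X, P X} -> P G) ->
  forall G, P G.
Proof.
move=> IH -[t lt]; elim/tree_indm: t lt => t IHl IHr lt.
apply: IH => -[u lu]; rewrite (mem_lopts, mem_ropts) => /= tin.
  exact: IHl.
exact: IHr.
Qed.

Lemma side_opts_tree s : side_opts (tree_side s) = if s is inr X then X else fset0.
Proof.
apply/fsetP => Y; rewrite mem_side_opts; case: s => [a|X] //=.
by rewrite sort_keysE (mem_map val_inj).
Qed.

Lemma lopts_gform l r (hl : nonempty_side l) (hr : nonempty_side r) :
  lopts (gform hl hr) = if l is inr X then X else fset0.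
Proof. exact: side_opts_tree. Qed.

Lemma ropts_gform l r (hl : nonempty_side l) (hr : nonempty_side r) :
  ropts (gform hl hr) = if r is inr X then X else fset0.
Proof. exact: side_opts_tree. Qed.

Lemma ladorn_gform l r (hl : nonempty_side l) (hr : nonempty_side r) :
  ladorn (gform hl hr) = if l is inl a then Some a else None.
Proof. by case: l hl. Qed.

Lemma radorn_gform l r (hl : nonempty_side l) (hr : nonempty_side r) :
  radorn (gform hl hr) = if r is inl a then Some a else None.
Proof. by case: r hr. Qed.

End Tree.

(* < emptyset^a | emptyset^a > *)
Definition gnum (A : choiceType) (a : A) : game A :=
  @gform A (inl a) (inl a) isT isT.

Section Sum.
Variable A : zmodType.
Implicit Types (G H X : game A).

Definition map_opts (f : tree A -> tree A) (s : A + seq (tree A)) :=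
  if s is inr ts then map f ts else [::].

Definition add_side (f g : tree A -> tree A) (s s' : A + seq (tree A)) :
    A + seq (tree A) :=
  match s, s' with
  | inl a, inl b => inl (a + b)
  | _, _ => inr (sort_keys (map_opts f s ++ map_opts g s'))
  end.

Fixpoint tadd (t : tree A) : tree A -> tree A :=
  fix tadd_t (u : tree A) : tree A :=
    match t, u with
    | Node tl tr, Node ul ur =>
      Node (add_side (tadd ^~ u) tadd_t tl ul) (add_side (tadd ^~ u) tadd_t tr ur)
    end.

Definition conj_side (f : tree A -> tree A) (s : A + seq (tree A)) :
    A + seq (tree A) :=
  match s with
  | inl a => inl (- a)
  | inr ts => inr (sort_keys (map f ts))
  end.

Fixpoint tconj (t : tree A) : tree A :=
  let: Node l r := t in Node (conj_side tconj r) (conj_side tconj l).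

Lemma tadd_left t u : tleft (tadd t u) =
  add_side (tadd ^~ u) (tadd t) (tleft t) (tleft u).
Proof. by case: t u => [? ?] [? ?]. Qed.

Lemma tadd_right t u : tright (tadd t u) =
  add_side (tadd ^~ u) (tadd t) (tright t) (tright u).
Proof. by case: t u => [? ?] [? ?]. Qed.

Lemma mem_map_opts f s t :
  reflect (exists2 x, x \in topts s & t = f x) (t \in map_opts f s).
Proof.
by case: s => [a|xs] /=; [constructor; case | apply: mapP].
Qed.

Lemma topts_add_side f g s s' :
  topts (add_side f g s s') =i map_opts f s ++ map_opts g s'.
Proof. by case: s s' => [a|xs] [b|ys] t //=; rewrite sort_keysE. Qed.

Lemma add_side_literal f g s s' : literal_side s -> literal_side s' ->
    {in topts s, forall x, literal (f x)} ->
    {in topts s', forall x, literal (g x)} ->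
  literal_side (add_side f g s s').
Proof.
move=> ls ls' lf lg.
have alll : all (@literal A) (topts (add_side f g s s')).
  apply/allP => t; rewrite topts_add_side mem_cat.
  by case/orP=> /mem_map_opts[x xs ->]; [apply: lf | apply: lg].
case: s s' ls ls' {lf lg} alll => [a|[|x xs]] [b|[|y ys]] //= _ _ ->;
by rewrite sort_keys_eq0 canonical_sort_keys.
Qed.

Lemma tadd_literal t u : literal t -> literal u -> literal (tadd t u).
Proof.
elim/tree_indm: t u => t IHtl IHtr; elim/tree_indm=> u IHul IHur lt lu.
have := lt; rewrite literalE => /andP[tl tr].
have := lu; rewrite literalE => /andP[ul ur].
rewrite literalE tadd_left tadd_right !add_side_literal // => x xin.
- by apply: IHtr => //; exact: topts_literal xin.
- by apply: IHur => //; exact: topts_literal xin.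
- by apply: IHtl => //; exact: topts_literal xin.
- by apply: IHul => //; exact: topts_literal xin.
Qed.

Lemma tconj_left t : tleft (tconj t) = conj_side tconj (tright t).
Proof. by case: t. Qed.

Lemma tconj_right t : tright (tconj t) = conj_side tconj (tleft t).
Proof. by case: t. Qed.

Lemma topts_conj_side f s : topts (conj_side f s) =i map_opts f s.
Proof. by case: s => [a|xs] t //=; rewrite sort_keysE. Qed.

Lemma conj_side_literal f s : literal_side s ->
  {in topts s, forall x, literal (f x)} -> literal_side (conj_side f s).
Proof.
move=> ls lf.
have alll : all (@literal A) (topts (conj_side f s)).
  by apply/allP => t; rewrite topts_conj_side => /mem_map_opts[x xs ->]; exact: lf.
case: s ls {lf} alll => [a|[|x xs]] //= _ ->.
by rewrite sort_keys_eq0 canonical_sort_keys.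
Qed.

Lemma tconj_literal t : literal t -> literal (tconj t).
Proof.
elim/tree_indm: t => t IHl IHr; rewrite !literalE => /andP[tl tr].
rewrite tconj_left tconj_right !conj_side_literal // => x xin.
- by apply: IHl => //; exact: topts_literal xin.
- by apply: IHr => //; exact: topts_literal xin.
Qed.

Definition gadd G H : game A :=
  Game (tadd_literal (game_literal G) (game_literal H)).

Definition gconj G : game A := Game (tconj_literal (game_literal G)).

Definition adorn_add (a b : option A) : option A :=
  if (a, b) is (Some x, Some y) then Some (x + y) else None.

Lemma ladorn_gadd G H : ladorn (gadd G H) = adorn_add (ladorn G) (ladorn H).
Proof.
by rewrite /ladorn /= tadd_left; case: (tleft _) (tleft _) => [a|xs] [b|ys].
Qed.

Lemma radorn_gadd G H : radorn (gadd G H) = adorn_add (radorn G) (radorn H).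
Proof.
by rewrite /radorn /= tadd_right; case: (tright _) (tright _) => [a|xs] [b|ys].
Qed.

Lemma lopts_gadd G H : lopts (gadd G H) =
  [fset gadd X H | X in lopts G] `|` [fset gadd G X | X in lopts H].
Proof.
apply/fsetP => Y; rewrite mem_lopts /= tadd_left topts_add_side mem_cat in_fsetU.
congr (_ || _); apply/mem_map_opts/imfsetP => /= -[x xin eqx].
- have lx := topts_literal (literal_left G) xin.
  by exists (Game lx); [rewrite mem_lopts | apply: val_inj].
- by exists (tree_of x); [rewrite -mem_lopts | rewrite eqx].
- have lx := topts_literal (literal_left H) xin.
  by exists (Game lx); [rewrite mem_lopts | apply: val_inj].
- by exists (tree_of x); [rewrite -mem_lopts | rewrite eqx].
Qed.

Lemma ropts_gadd G H : ropts (gadd G H) =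
  [fset gadd X H | X in ropts G] `|` [fset gadd G X | X in ropts H].
Proof.
apply/fsetP => Y; rewrite mem_ropts /= tadd_right topts_add_side mem_cat in_fsetU.
congr (_ || _); apply/mem_map_opts/imfsetP => /= -[x xin eqx].
- have lx := topts_literal (literal_right G) xin.
  by exists (Game lx); [rewrite mem_ropts | apply: val_inj].
- by exists (tree_of x); [rewrite -mem_ropts | rewrite eqx].
- have lx := topts_literal (literal_right H) xin.
  by exists (Game lx); [rewrite mem_ropts | apply: val_inj].
- by exists (tree_of x); [rewrite -mem_ropts | rewrite eqx].
Qed.

Lemma ladorn_gconj G : ladorn (gconj G) = omap -%R (radorn G).
Proof. by rewrite /ladorn /radorn /= tconj_left; case: (tright _). Qed.

Lemma radorn_gconj G : radorn (gconj G) = omap -%R (ladorn G).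
Proof. by rewrite /ladorn /radorn /= tconj_right; case: (tleft _). Qed.

Lemma lopts_gconj G : lopts (gconj G) = [fset gconj X | X in ropts G].
Proof.
apply/fsetP => Y; rewrite mem_lopts /= tconj_left topts_conj_side.
apply/mem_map_opts/imfsetP => /= -[x xin eqx].
- have lx := topts_literal (literal_right G) xin.
  by exists (Game lx); [rewrite mem_ropts | apply: val_inj].
- by exists (tree_of x); [rewrite -mem_ropts | rewrite eqx].
Qed.

Lemma ropts_gconj G : ropts (gconj G) = [fset gconj X | X in lopts G].
Proof.
apply/fsetP => Y; rewrite mem_ropts /= tconj_right topts_conj_side.
apply/mem_map_opts/imfsetP => /= -[x xin eqx].
- have lx := topts_literal (literal_left G) xin.
  by exists (Game lx); [rewrite mem_lopts | apply: val_inj].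
- by exists (tree_of x); [rewrite -mem_lopts | rewrite eqx].
Qed.

End Sum.

Local Open Scope order_scope.

Record totally_ordered_group (A : porderZmodType) : Prop := {
  tog_total : total (<=%R : rel A);
  tog_add : forall x y z : A, (x <= y)%R -> (x + z <= y + z)%R
}.

Record game_space (A : porderZmodType) (d : Order.disp_t) (S : orderType d) := {
  nuL : A -> S;
  nuR : A -> S;
  nuL_homo : forall a b : A, (a <= b)%R -> nuL a <= nuL b;
  nuR_homo : forall a b : A, (a <= b)%R -> nuR a <= nuR b;
  nu_eq : (exists a b : A, a <> b) -> forall a, nuL a = nuR a;
  nu_surj : forall s : S, exists a : A, s = nuL a \/ s = nuR a
}.

Section Outcome.
Variables (A : porderZmodType) (d : Order.disp_t) (S : orderType d).
Variable (sp : game_space A S).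
Implicit Types (G H X : game A).

(* The empty lists never occur in a game. *)
Definition max_list (ys : seq S) : S :=
  if ys is y :: ys' then \big[Order.max/y]_(z <- ys') z else nuL sp 0%R.
Definition min_list (ys : seq S) : S :=
  if ys is y :: ys' then \big[Order.min/y]_(z <- ys') z else nuR sp 0%R.

Fixpoint toutcome (t : tree A) : S * S :=
  let: Node l r := t in
  (match l with
   | inl a => nuL sp a
   | inr xs => max_list [seq (toutcome x).2 | x <- xs]
   end,
   match r with
   | inl a => nuR sp a
   | inr xs => min_list [seq (toutcome x).1 | x <- xs]
   end).

Definition oL G : S := (toutcome (tree_of G)).1.
Definition oR G : S := (toutcome (tree_of G)).2.

Lemma max_listP ys : ys != [::] ->
  max_list ys \in ys /\ {in ys, forall y, y <= max_list ys}.
Proof.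
case: ys => // y ys _ /=; elim: ys => [|z ys [IH1 IH2]].
  by rewrite big_nil mem_head; split=> // x; rewrite inE => /eqP ->.
rewrite big_cons; set m := \big[_/_]_(_ <- _) _ in IH1 IH2 *; split.
  by case: (leP z m) IH1; rewrite !inE ?eqxx ?orbT // => _ /orP[]->; rewrite ?orbT.
move=> x; rewrite !inE le_max => /or3P[/eqP->|/eqP->|xys]; rewrite ?lexx //.
  by rewrite IH2 ?orbT // mem_head.
by rewrite IH2 ?orbT // inE xys orbT.
Qed.

Lemma min_listP ys : ys != [::] ->
  min_list ys \in ys /\ {in ys, forall y, min_list ys <= y}.
Proof.
case: ys => // y ys _ /=; elim: ys => [|z ys [IH1 IH2]].
  by rewrite big_nil mem_head; split=> // x; rewrite inE => /eqP ->.
rewrite big_cons; set m := \big[_/_]_(_ <- _) _ in IH1 IH2 *; split.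
  by case: (leP z m) IH1; rewrite !inE ?eqxx ?orbT // => _ /orP[]->; rewrite ?orbT.
move=> x; rewrite !inE ge_min => /or3P[/eqP->|/eqP->|xys]; rewrite ?lexx //.
  by rewrite IH2 ?orbT // mem_head.
by rewrite IH2 ?orbT // inE xys orbT.
Qed.

Lemma oL_atomic G a : ladorn G = Some a -> oL G = nuL sp a.
Proof.
rewrite /ladorn /oL; case: (tree_of G) => [[b|xs] r] //=.
by case=> ->.
Qed.

Lemma oR_atomic G a : radorn G = Some a -> oR G = nuR sp a.
Proof.
rewrite /radorn /oR; case: (tree_of G) => [l [b|xs]] //=.
by case=> ->.
Qed.

Lemma oL_max G : ~~ left_atomic G ->
  (exists2 X, X \in lopts G & oL G = oR X) /\
  {in lopts G, forall X, oR X <= oL G}.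
Proof.
have := literal_left G; have := mem_lopts G.
rewrite /left_atomic /ladorn /oL.
case: (tree_of G) => [[b|xs] r] //= memG /and3P[xs0 _ /allP lxs] _.
have ys0 : [seq (toutcome x).2 | x <- xs] != [::] by case: (xs) xs0.
have [/mapP[x xin eqx] ub] := max_listP ys0; split.
  by exists (Game (lxs _ xin)); rewrite ?memG.
by move=> X; rewrite memG => Xin; apply: ub; exact: map_f.
Qed.

Lemma oR_min G : ~~ right_atomic G ->
  (exists2 X, X \in ropts G & oR G = oL X) /\
  {in ropts G, forall X, oR G <= oL X}.
Proof.
have := literal_right G; have := mem_ropts G.
rewrite /right_atomic /radorn /oR.
case: (tree_of G) => [l [b|xs]] //= memG /and3P[xs0 _ /allP lxs] _.
have ys0 : [seq (toutcome x).1 | x <- xs] != [::] by case: (xs) xs0.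
have [/mapP[x xin eqx] lb] := min_listP ys0; split.
  by exists (Game (lxs _ xin)); rewrite ?memG.
by move=> X; rewrite memG => Xin; apply: lb; exact: map_f.
Qed.

End Outcome.

Section Universe.
Variables (A : porderZmodType) (d : Order.disp_t) (S : orderType d).
Variable (sp : game_space A S).
Implicit Types (G H J X : game A).

Record universe (U : game A -> Prop) : Prop := {
  universe_num : forall a, U (gnum a);
  universe_lopts : forall G X, U G -> X \in lopts G -> U X;
  universe_ropts : forall G X, U G -> X \in ropts G -> U X;
  universe_add : forall G H, U G -> U H -> U (gadd G H);
  universe_conj : forall G, U G -> U (gconj G)
}.

Definition parental (U : game A -> Prop) : Prop :=
  forall (X Y : {fset game A}) (hX : X != fset0) (hY : Y != fset0),
    {in X, forall G, U G} -> {in Y, forall G, U G} ->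
    U (@gform A (inr X) (inr Y) hX hY).

Definition dense (U : game A -> Prop) : Prop :=
  forall G, U G -> forall x y : S,
    exists2 H, U H & oL sp (gadd G H) = x /\ oR sp (gadd G H) = y.

Record absolute_universe (U : game A -> Prop) : Prop := {
  absolute_is_universe : universe U;
  absolute_parental : parental U;
  absolute_dense : dense U
}.

Variable U : game A -> Prop.

Definition succeq G H : Prop := forall X, U X ->
  oL sp (gadd G X) >= oL sp (gadd H X) /\ oR sp (gadd G X) >= oR sp (gadd H X).

Definition proviso G H : Prop :=
  (forall X, U X -> left_atomic X -> oL sp (gadd G X) >= oL sp (gadd H X)) /\
  (forall X, U X -> right_atomic X -> oR sp (gadd G X) >= oR sp (gadd H X)).

(* [LR H G] and [LL H G]: Left Maintenance Strategies in the Left Provisional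
   Game [G, H] when Right, respectively Left, starts; note the order of the
   arguments.  All the positions reached from a pair of games of a universe U
   are again pairs of games of U, so membership in U is not recorded. *)
Inductive LR (H G : game A) : Type :=
| Answers of (forall GR, GR \in ropts G -> LL H GR)
           & (forall HL, HL \in lopts H -> LL HL G)
with LL (H G : game A) : Type :=
| MoveG GL of GL \in lopts G & proviso GL H & LR H GL
| MoveH HR of HR \in ropts H & proviso G HR & LR HR G.

Definition answerG H G (s : LR H G) GR (m : GR \in ropts G) : LL H GR :=
  let: Answers aG _ := s in aG GR m.

Definition answerH H G (s : LR H G) HL (m : HL \in lopts H) : LL HL G :=
  let: Answers _ aH := s in aH HL m.

(* [residual g f h]: h is the residual strategy of g in [G, J] and f in [J, H].
   [residual_g g f k]: Right has just moved in [G, J], g is the strategy there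
   with Left to answer, f is the strategy in [J, H] with Right to move, and the
   exchange of moves in J results in the answer k in [G, H] together with its
   continuation.  [residual_f g f k]: the same when Right has just moved
   in [J, H].  Being inductive, the exchange of moves in J is finite. *)
Inductive residual (H J G : game A) : LR J G -> LR H J -> LR H G -> Prop :=
| Residual (g : LR J G) (f : LR H J) (h : LR H G) of
    (forall GR (m : GR \in ropts G), residual_g (answerG g m) f (answerG h m)) &
    (forall HL (m : HL \in lopts H), residual_f g (answerH f m) (answerH h m)) :
    residual g f h
with residual_g (H J G : game A) : LL J G -> LR H J -> LL H G -> Prop :=
| Residual_gG GL (m : GL \in lopts G) (p : proviso GL J) (q : proviso GL H)
    (g : LR J GL) (f : LR H J) (h : LR H GL) of
    residual g f h : residual_g (MoveG m p g) f (MoveG m q h)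
| Residual_gJ JR (m : JR \in ropts J) (p : proviso G JR)
    (g : LR JR G) (f : LR H J) (k : LL H G) of
    residual_f g (answerG f m) k : residual_g (MoveH m p g) f k
with residual_f (H J G : game A) : LR J G -> LL H J -> LL H G -> Prop :=
| Residual_fH HR (m : HR \in ropts H) (p : proviso J HR) (q : proviso G HR)
    (g : LR J G) (f : LR HR J) (h : LR HR G) of
    residual g f h : residual_f g (MoveH m p f) (MoveH m q h)
| Residual_fJ JL (m : JL \in lopts J) (p : proviso JL H)
    (g : LR J G) (f : LR H JL) (k : LL H G) of
    residual_g (answerH g m) f k : residual_f g (MoveG m p f) k.

Record object := Object { object_game :> game A; object_in : U object_game }.

(* Hom(H, G) is LR H G if G succeq H, and is empty otherwise. *)
Record LHom (H G : object) : Type := MkLHom {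
  LHom_strategy : LR H G;
  LHom_succeq : succeq G H
}.

End Universe.

Record is_category (Ob : Type) (Mor : Ob -> Ob -> Type)
    (comp : forall X Y Z, Mor Y Z -> Mor X Y -> Mor X Z) : Prop := {
  comp_assoc : forall W X Y Z (h : Mor Y Z) (g : Mor X Y) (f : Mor W X),
    comp W Y Z h (comp W X Y g f) = comp W X Z (comp X Y Z h g) f;
  comp_id : forall X, exists i : Mor X X,
    (forall W (f : Mor W X), comp W X X i f = f) /\
    (forall Y (g : Mor X Y), comp X X Y g i = g)
}.

(* Main.v *)
Require Import Defs.
From HB Require Import structures.
From mathcomp Require Import all_boot all_order all_algebra.
From mathcomp Require Import finmap zify.
From Stdlib Require Import FunctionalExtensionality ProofIrrelevance.

Set Implicit Arguments.
Unset Strict Implicit.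
Unset Printing Implicit Defensive.

(** Composition of strategies is parallel play on three boards with the middle
    one hidden.  Put G, J, H next to each other, with g playing in [G, J] and f
    playing in [J, H]: every step of the exchange, visible or hidden, is a move
    in one of the three games, so the sum of their ranks strictly decreases.
    Induction on this sum shows that the exchange always ends in a visible
    answer, that the answer is unique, and that it is legal: whenever Left has
    just answered in [G, J] or in [J, H] that pair satisfies the proviso, at the
    start both pairs do because G >= J >= H, and the proviso is transitive
    ([residual_exists_unique]).

    For associativity put four games Z, Y, X, W next to each other.  The two
    ways of bracketing compute the same play on all four boards and differ only
    in the order in which the inner boards Y and X are hidden.  The induction
    over such plays distinguishes whose turn it is to answer: nobody's (Right is
    about to move), h's in [Z, Y], g's in [Y, X], or f's in [X, W]
    ([residual_assoc]).

    The identity on G is the copycat strategy in [G, G], whose answers satisfy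
    the proviso by reflexivity.  Composed with any strategy it merely relays
    moves between its two copies of G ([residual_copycat_l],
    [residual_copycat_r]).

    Strategies are compared by Leibniz equality, so functional extensionality
    identifies families of answers, and proof irrelevance identifies proofs that
    a move is legal. *)

(** * Rank of a game *)

Section Rank.
Variable A : choiceType.

Fixpoint trank (t : tree A) : nat :=
  let side s := if s is inr xs then sumn (map trank xs) else 0 in
  let: Node l r := t in (side l + side r).+1.

Definition rank (G : game A) : nat := trank (tree_of G).

Lemma trank_side (s : A + seq (tree A)) x : x \in topts s ->
  trank x <= if s is inr xs then sumn (map trank xs) else 0.
Proof.
case: s => //= xs; elim: xs => //= y ys IH; rewrite inE => /predU1P[->|/IH];
by lia.
Qed.

Lemma rank_lopts G X : X \in lopts G -> rank X < rank G.
Proof.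
rewrite mem_lopts /rank; case: (tree_of G) => l r /= /trank_side.
by case: l => [a|xs] /=; lia.
Qed.

Lemma rank_ropts G X : X \in ropts G -> rank X < rank G.
Proof.
rewrite mem_ropts /rank; case: (tree_of G) => l r /= /trank_side.
by case: r => [a|xs] /=; lia.
Qed.

End Rank.

Section Strategies.
Variables (A : porderZmodType) (d : Order.disp_t) (S : orderType d).
Variables (sp : game_space A S) (U : game A -> Prop).
Implicit Types G H J W X Y Z : game A.

Local Notation LR := (LR sp U).
Local Notation LL := (LL sp U).
Local Notation proviso := (proviso sp U).
Local Notation succeq := (succeq sp U).

(** * Order and proviso *)

Lemma proviso_refl G : proviso G G.
Proof. by split=> X _ _; exact: Order.POrderTheory.lexx. Qed.

Lemma proviso_trans G J H : proviso G J -> proviso J H -> proviso G H.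
Proof.
move=> [GJl GJr] [JHl JHr]; split=> X UX aX.
  exact: Order.POrderTheory.le_trans (JHl X UX aX) (GJl X UX aX).
exact: Order.POrderTheory.le_trans (JHr X UX aX) (GJr X UX aX).
Qed.

Lemma succeq_refl G : succeq G G.
Proof. by move=> X _; split; exact: Order.POrderTheory.lexx. Qed.

Lemma succeq_trans G J H : succeq G J -> succeq J H -> succeq G H.
Proof.
move=> GJ JH X UX; have [GJl GJr] := GJ X UX; have [JHl JHr] := JH X UX.
split; first exact: Order.POrderTheory.le_trans JHl GJl.
exact: Order.POrderTheory.le_trans JHr GJr.
Qed.

Lemma succeq_proviso G H : succeq G H -> proviso G H.
Proof. by move=> GH; split=> X UX _; have [] := GH X UX. Qed.

(** * Residual strategies exist and are unique *)

Lemma LR_ext H G (s t : LR H G) :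
  (forall GR (m : GR \in ropts G), answerG s m = answerG t m) ->
  (forall HL (m : HL \in lopts H), answerH s m = answerH t m) -> s = t.
Proof.
case: s t => [aG aH] [bG bH] /= eqG eqH.
by congr Answers; do 2 (apply: functional_extensionality_dep => ?).
Qed.

Lemma residualE H J G (g : LR J G) (f : LR H J) (h : LR H G) :
  residual g f h <->
  (forall GR (m : GR \in ropts G), residual_g (answerG g m) f (answerG h m)) /\
  (forall HL (m : HL \in lopts H), residual_f g (answerH f m) (answerH h m)).
Proof. by split=> [[]|[]]. Qed.

Lemma residual_gE H J G (g : LL J G) (f : LR H J) (k : LL H G) :
  residual_g g f k <->
  match g with
  | MoveG _ m _ g' => exists q h, k = MoveG m q h /\ residual g' f h
  | MoveH _ m _ g' => residual_f g' (answerG f m) k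
  end.
Proof.
split=> [[]|]; first by move=> GL m p q g' f' h res; exists q, h.
  by [].
case: g => [GL m p g' [q [h [-> res]]]|JR m p g' res].
  exact: Residual_gG.
exact: Residual_gJ.
Qed.

Lemma residual_fE H J G (g : LR J G) (f : LL H J) (k : LL H G) :
  residual_f g f k <->
  match f with
  | MoveG _ m _ f' => residual_g (answerH g m) f' k
  | MoveH _ m _ f' => exists q h, k = MoveH m q h /\ residual g f' h
  end.
Proof.
split=> [[]|]; first by move=> HR m p q g' f' h res; exists q, h.
  by [].
case: f => [JL m p f' res|HR m p f' [q [h [-> res]]]].
  exact: Residual_fJ.
exact: Residual_fH.
Qed.

(** The three parts are the three possible states of the exchange.  The pair in
    which Right has just moved need not satisfy the proviso, which is why the
    second part assumes it for [J, H] only, and the third for [G, J] only; the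
    answer about to be given restores it for the other pair. *)
Lemma residual_exists_unique_rec n H J G : rank G + rank J + rank H < n ->
  (forall (g : LR J G) (f : LR H J), proviso G J -> proviso J H ->
     {k | forall k', residual g f k' <-> k' = k}) *
  (forall (g : LL J G) (f : LR H J), proviso J H ->
     {k | forall k', residual_g g f k' <-> k' = k}) *
  (forall (g : LR J G) (f : LL H J), proviso G J ->
     {k | forall k', residual_f g f k' <-> k' = k}).
Proof.
elim: n H J G => [|n IH] H J G //; rewrite ltnS => le_n; split; first split.
- move=> g f GJ JH.
  have kG GR (m : GR \in ropts G) :
      {k | forall k', residual_g (answerG g m) f k' <-> k' = k}.
    by apply: (IH H J GR _).1.2 => //; have := rank_ropts m; lia.
  have kH HL (m : HL \in lopts H) :
      {k | forall k', residual_f g (answerH f m) k' <-> k' = k}.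
    by apply: (IH HL J G _).2 => //; have := rank_lopts m; lia.
  exists (Answers (fun GR m => sval (kG GR m)) (fun HL m => sval (kH HL m))).
  move=> k'; rewrite residualE; split=> [[resG resH]|->].
    apply: LR_ext => [GR m|HL m] /=.
      by apply/(svalP (kG GR m)).
    by apply/(svalP (kH HL m)).
  by split=> [GR m|HL m] /=; [apply/(svalP (kG GR m)) | apply/(svalP (kH HL m))].
- case=> [GL m GLJ g|JR m GJR g] f JH.
    have lt : rank GL + rank J + rank H < n by have := rank_lopts m; lia.
    have [k kP] := (IH H J GL lt).1.1 g f GLJ JH.
    exists (MoveG m (proviso_trans GLJ JH) k) => k'; rewrite residual_gE; split.
      move=> [q [h [-> /kP ->]]]; congr MoveG; exact: proof_irrelevance.
    by move=> ->; exists (proviso_trans GLJ JH), k; split=> //; apply/kP.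
  have lt : rank G + rank JR + rank H < n by have := rank_ropts m; lia.
  have [k kP] := (IH H JR G lt).2 g (answerG f m) GJR.
  by exists k => k'; rewrite residual_gE.
- move=> g [JL m JLH f|HR m JHR f] GJ.
    have lt : rank G + rank JL + rank H < n by have := rank_lopts m; lia.
    have [k kP] := (IH H JL G lt).1.2 (answerH g m) f JLH.
    by exists k => k'; rewrite residual_fE.
  have lt : rank G + rank J + rank HR < n by have := rank_ropts m; lia.
  have [k kP] := (IH HR J G lt).1.1 g f GJ JHR.
  exists (MoveH m (proviso_trans GJ JHR) k) => k'; rewrite residual_fE; split.
    move=> [q [h [-> /kP ->]]]; congr MoveH; exact: proof_irrelevance.
  by move=> ->; exists (proviso_trans GJ JHR), k; split=> //; apply/kP.
Qed.

Lemma residual_exists_unique H J G (g : LR J G) (f : LR H J) :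
  proviso G J -> proviso J H -> {k | forall k', residual g f k' <-> k' = k}.
Proof. exact: (residual_exists_unique_rec (ltnSn _)).1.1. Qed.

(** * Associativity *)

(** The four parts are the four states of a play on Z, Y, X, W: Right is to
    move, or it is the turn of h, of g, or of f to answer.  When it is the turn
    of g, hg is to answer in [Z, X] and gf is to answer in [Y, W]: this is where
    the two bracketings see the same state from different sides.  The exchange
    in X between g and f does not involve the derivation of k, so the induction
    is on the ranks, which every move decreases. *)
Lemma residual_assoc_rec n W X Y Z : rank Z + rank Y + rank X + rank W < n ->
  [/\ forall (h : LR Y Z) (g : LR X Y) (f : LR W X) hg gf k,
        residual h g hg -> residual g f gf -> residual h gf k ->
        residual hg f k,
      forall (h : LL Y Z) (g : LR X Y) (f : LR W X) hg gf k,
        residual_g h g hg -> residual g f gf -> residual_g h gf k ->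
        residual_g hg f k,
      forall (h : LR Y Z) (g : LL X Y) (f : LR W X) hg gf k,
        residual_f h g hg -> residual_g g f gf -> residual_f h gf k ->
        residual_g hg f k
    & forall (h : LR Y Z) (g : LR X Y) (f : LL W X) hg gf k,
        residual h g hg -> residual_f g f gf -> residual_f h gf k ->
        residual_f hg f k].
Proof.
elim: n W X Y Z => [|n IH] W X Y Z //; rewrite ltnS => le_n; split.
- move=> h g f hg gf k hgP gfP /residualE[kZ kW].
  have [hgZ _] := (residualE _ _ _).1 hgP.
  have [_ gfW] := (residualE _ _ _).1 gfP.
  apply/residualE; split=> [ZR m|WL m].
    have lt : rank ZR + rank Y + rank X + rank W < n.
      by have := rank_ropts m; lia.
    by have [_ IH1 _ _] := IH W X Y ZR lt; apply: IH1 (hgZ _ m) gfP (kZ _ m).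
  have lt : rank Z + rank Y + rank X + rank WL < n.
    by have := rank_lopts m; lia.
  by have [_ _ _ IH3] := IH WL X Y Z lt; apply: IH3 hgP (gfW _ m) (kW _ m).
- move=> [ZL m p h|YR m p h] g f hg gf k.
    move=> /residual_gE[q [hg' [-> hgP]]] gfP /residual_gE[q' [k' [-> kP]]].
    have lt : rank ZL + rank Y + rank X + rank W < n.
      by have := rank_lopts m; lia.
    have [IH0 _ _ _] := IH W X Y ZL lt.
    by apply: Residual_gG; apply: IH0 hgP gfP kP.
  move=> /residual_gE hgP /residualE[gfY _] /residual_gE kP.
  have lt : rank Z + rank YR + rank X + rank W < n.
    by have := rank_ropts m; lia.
  by have [_ _ IH2 _] := IH W X YR Z lt; apply: IH2 hgP (gfY _ m) kP.
- move=> h [YL m p g|XR m p g] f hg gf k.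
    move=> /residual_fE hgP /residual_gE[q [gf' [-> gfP]]] /residual_fE kP.
    have lt : rank Z + rank YL + rank X + rank W < n.
      by have := rank_lopts m; lia.
    by have [_ IH1 _ _] := IH W X YL Z lt; apply: IH1 hgP gfP kP.
  move=> /residual_fE[q [hg' [-> hgP]]] /residual_gE gfP kP.
  have lt : rank Z + rank Y + rank XR + rank W < n.
    by have := rank_ropts m; lia.
  have [_ _ _ IH3] := IH W XR Y Z lt.
  by apply: Residual_gJ; apply: IH3 hgP gfP kP.
- move=> h g [XL m p f|WR m p f] hg gf k.
    move=> /residualE[_ hgX] /residual_fE gfP kP.
    have lt : rank Z + rank Y + rank XL + rank W < n.
      by have := rank_lopts m; lia.
    have [_ _ IH2 _] := IH W XL Y Z lt.
    by apply: Residual_fJ; apply: IH2 (hgX _ m) gfP kP.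
  move=> hgP /residual_fE[q [gf' [-> gfP]]] /residual_fE[q' [k' [-> kP]]].
  have lt : rank Z + rank Y + rank X + rank WR < n.
    by have := rank_ropts m; lia.
  have [IH0 _ _ _] := IH WR X Y Z lt.
  by apply: Residual_fH; apply: IH0 hgP gfP kP.
Qed.

Lemma residual_assoc W X Y Z (h : LR Y Z) (g : LR X Y) (f : LR W X) hg gf k :
  residual h g hg -> residual g f gf -> residual h gf k -> residual hg f k.
Proof.
have [assoc _ _ _] :=
  residual_assoc_rec (ltnSn (rank Z + rank Y + rank X + rank W)).
exact: assoc.
Qed.

(** * The copycat strategy *)

Lemma rank_ropts_le n G GR : rank G <= n.+1 -> GR \in ropts G -> rank GR <= n.
Proof. by move=> le_n /rank_ropts; lia. Qed.

Lemma rank_lopts_le n G GL : rank G <= n.+1 -> GL \in lopts G -> rank GL <= n.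
Proof. by move=> le_n /rank_lopts; lia. Qed.

Lemma rank_gt0 G : ~~ (rank G <= 0).
Proof. by rewrite /rank; case: (tree_of G). Qed.

(** The bound n is fuel for the recursion: options of a game are not structural
    subterms of it.  The case n = 0 is void because ranks are positive. *)
Fixpoint copycat n : forall G, rank G <= n -> LR G G :=
  match n with
  | 0 => fun G le0 => False_rect _ (negP (rank_gt0 G) le0)
  | n'.+1 => fun G le_n =>
    Answers
      (fun GR m => MoveH m (proviso_refl GR) (copycat (rank_ropts_le le_n m)))
      (fun GL m => MoveG m (proviso_refl GL) (copycat (rank_lopts_le le_n m)))
  end.

Scheme LR_mutual_ind := Induction for Defs.LR Sort Prop
  with LL_mutual_ind := Induction for Defs.LL Sort Prop.
Combined Scheme strategy_ind from LR_mutual_ind, LL_mutual_ind.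

(** Right's moves in G reach f through the copy, and f's answers in the hidden
    copy of G are repeated in the visible one; hence f is reproduced. *)
Lemma residual_copycat_l_rec : forall H G,
  (forall (f : LR H G) n (le_n : rank G <= n),
     residual (copycat le_n) f f) /\
  (forall (f : LL H G) n (le_n : rank G <= n),
     residual_f (copycat le_n) f f).
Proof.
apply: strategy_ind => [H G aG IHG aH IHH|H G GL m p f IH|H G HR m p f IH].
- move=> [|n] le_n; first by case: (negP (rank_gt0 G)).
  apply/residualE; split=> [GR m|HL m] /=; last exact: (IHH _ _ n.+1).
  exact/Residual_gJ/IHG.
- move=> [|n] le_n; first by case: (negP (rank_gt0 G)).
  exact/Residual_fJ/Residual_gG/IH.
- by move=> n le_n; exact/Residual_fH/IH.
Qed.

Lemma residual_copycat_l H G (f : LR H G) n (le_n : rank G <= n) :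
  residual (copycat le_n) f f.
Proof. exact: (residual_copycat_l_rec _ _).1. Qed.

Lemma residual_copycat_r_rec : forall H G,
  (forall (g : LR H G) n (le_n : rank H <= n),
     residual g (copycat le_n) g) /\
  (forall (g : LL H G) n (le_n : rank H <= n),
     residual_g g (copycat le_n) g).
Proof.
apply: strategy_ind => [H G aG IHG aH IHH|H G GL m p g IH|H G HR m p g IH].
- move=> [|n] le_n; first by case: (negP (rank_gt0 H)).
  apply/residualE; split=> [GR m|HL m] /=; first exact: (IHG _ _ n.+1).
  exact/Residual_fJ/IHH.
- by move=> n le_n; exact/Residual_gG/IH.
- move=> [|n] le_n; first by case: (negP (rank_gt0 H)).
  exact/Residual_gJ/Residual_fH/IH.
Qed.

Lemma residual_copycat_r H G (g : LR H G) n (le_n : rank H <= n) :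
  residual g (copycat le_n) g.
Proof. exact: (residual_copycat_r_rec _ _).1. Qed.

(** * The category *)

Lemma LHom_inj (H G : object U) (f g : LHom sp H G) :
  LHom_strategy f = LHom_strategy g -> f = g.
Proof.
case: f g => [s p] [t q] /= ->; congr MkLHom; exact: proof_irrelevance.
Qed.

Definition LHom_id (G : object U) : LHom sp G G :=
  MkLHom (copycat (leqnn (rank G))) (succeq_refl G).

Definition LHom_residual (H J G : object U) (g : LHom sp J G) (f : LHom sp H J) :
    {k | forall k', residual (LHom_strategy g) (LHom_strategy f) k' <-> k' = k} :=
  residual_exists_unique (LHom_strategy g) (LHom_strategy f)
    (succeq_proviso (LHom_succeq g)) (succeq_proviso (LHom_succeq f)).

Definition LHom_comp (H J G : object U) (g : LHom sp J G) (f : LHom sp H J) :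
    LHom sp H G :=
  MkLHom (sval (LHom_residual g f))
    (succeq_trans (LHom_succeq g) (LHom_succeq f)).

Lemma residual_LHom_comp (H J G : object U) (g : LHom sp J G) (f : LHom sp H J)
    (h : LHom sp H G) :
  residual (LHom_strategy g) (LHom_strategy f) (LHom_strategy h) <->
  h = LHom_comp g f.
Proof.
split=> [/(svalP (LHom_residual g f)) eq_h|->]; first exact: LHom_inj.
exact/(svalP (LHom_residual g f)).
Qed.

Lemma LHom_category : is_category LHom_comp.
Proof.
split=> [W X Y Z h g f|G].
  apply/residual_LHom_comp.
  by apply: residual_assoc; apply/residual_LHom_comp.
exists (LHom_id G); split=> [H f|H g]; symmetry; apply/residual_LHom_comp.
  exact: residual_copycat_l.
exact: residual_copycat_r.
Qed.

End Strategies.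

Theorem theorem3p8 (A : porderZmodType) (hA : totally_ordered_group A)
    (d : Order.disp_t) (S : orderType d) (sp : game_space A S)
    (U : game A -> Prop) (hU : absolute_universe sp U) :
  exists comp : forall H J G : object U,
      LHom sp J G -> LHom sp H J -> LHom sp H G,
    (forall (H J G : object U) (g : LHom sp J G) (f : LHom sp H J)
        (h : LHom sp H G),
      residual (LHom_strategy g) (LHom_strategy f) (LHom_strategy h)
        <-> h = comp H J G g f) /\
    is_category comp.
Proof.
exists (@LHom_comp A d S sp U); split; last exact: LHom_category.
exact: residual_LHom_comp.
Qed.
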